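(* Suppose that Assumptions A and B hold for the $N$-player game described in the context, and that $\mathrm{VI}(X,F)$ satisfies the acute angle property: $(x-x^* )^\top F(x)>0$ for all $x\in X\setminus X^*$ and all $x^*\in X^*$. Let $\{x^k\}_{k=0}^\infty$ be generated by the stochastic synchronous gradient-response (SSGR) scheme with stepsizes $\{\gamma^k\}_{k\ge 0}$ satisfying $\sum_{k=0}^\infty \gamma^k=\infty$ and $\sum_{k=0}^\infty(\gamma^k)^2<\infty$. If $X^*$ is compact, then, almost surely, some subsequence of $\{x^k\}_{k=0}^\infty$ converges to a quasi-Nash equilibrium.
   Context: Game. Let $[N]=\{1,\dots,N\}$ and let $\boldsymbol{\xi}:\Omega\to\mathbb{R}^m$ be a random variable on a probability space $(\Omega,\mathcal F,\mathbb P)$ with $\Xi=\{\boldsymbol\xi(\omega)\mid\omega\in\Omega\}$. Player $i\in[N]$ has strategy set $X_i\subseteq\mathbb{R}^{n_i}$; $X=\prod_{i=1}^N X_i$, $X_{-i}=\prod_{j\ne i}X_j$, $x_{-i}=(x_j)_{j\neq i}$. Given $x_{-i}\in X_{-i}$, player $i$ solves $\min_{x_i\in X_i} f_i(x_i,x_{-i})=\mathbb E[\tilde f_i(x_i,x_{-i},\boldsymbol\xi)]$, where $\tilde f_i:X\times\Xi\to\mathbb R$. Put $F(x)=(\nabla_{x_i}f_i(x_i,x_{-i}))_{i=1}^N$. $\mathrm{VI}(X,F)$: find $x^*\in X$ with $F(x^* )^\top(x-x^* )\ge 0$ for all $x\in X$; its solution set is $X^*$. A point $x^*=(x_i^* )_{i=1}^N\in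 X$ is a quasi-Nash equilibrium (QNE) if $\nabla_{x_i}f_i(x_i^*,x_{-i}^* )^\top(x_i-x_i^* )\ge0$ for all $x_i\in X_i$ and all $i\in[N]$; equivalently $x^*\in X^*$. Assumption A. (A1) Each $X_i$ is convex and closed. (A2) For each $i$ and each $x_{-i}\in X_{-i}$, $f_i(\bullet,x_{-i})$ is $C^1$ on an open set $\mathcal O_i\supseteq X_i$ and $\nabla_{x_i}f_i(x_i,x_{-i})=\mathbb E[\nabla_{x_i}\tilde f_i(x_i,x_{-i},\boldsymbol\xi)]$. (A3) $X^*$ is closed and nonempty. SSGR scheme. Given $x^0\in X$ and stepsizes $\{\gamma^k\}_{k\ge0}$, for each $k\geq 0$ and each $i\in[N]$ generate an i.i.d. realization $\xi_i^k$ of $\boldsymbol\xi$ and set $x_i^{k+1}=\Pi_{X_i}[x_i^k-\gamma^k\nabla_{x_i}\tilde f_i(x_i^k,x_{-i}^k,\xi_i^k)]$, where $\Pi$ is Euclidean projection. History: $\mathcal F_k=\sigma\{x^0,\cup_{t=0}^{k-1}\{\nabla_{x_i}\tilde f_i(x^t,\xi_i^t)\}_{i=1}^N\}$. Assumption B. With $w_i^k=\nabla_{x_i}\tilde f_i(x_i^k,x_{-i}^k,\xi_i^k)-\nabla_{x_i}\mathbb E[\tilde f_i(x_i^k,x_{-i}^k,\boldsymbol\xi)]$ and $w^k=(w_i^k)_{i=1}^N$: (B1) $\mathbb E[w^k\mid\mathcal F_k]=0$ for all $k\ge0$; (B2) $\mathbb E[\|w^k\|^2\mid\mathcal F_k]\le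 M_w^2$ for all $k\ge0$ and some $M_w>0$; (B3) $\|F(x)\|\le M_F$ for all $x\in X$ and some $M_F>0$.
   Formalization: The formal theorem additionally assumes that F is jointly continuous on X (Assumption A only gives continuity of each player's gradient in that player's own strategy), without which the claim fails for N ≥ 2; stepsizes are taken nonnegative. *)

(* Defs.v *)
From HB Require Import structures.
From mathcomp Require Import all_boot all_order all_algebra.
From mathcomp Require Import all_classical all_reals all_analysis.

Set Implicit Arguments.
Unset Strict Implicit.
Unset Printing Implicit Defensive.

Import Order.TTheory GRing.Theory Num.Theory.
Import numFieldNormedType.Exports.

Local Open Scope classical_set_scope.
Local Open Scope ring_scope.

(* MathComp-Analysis equips 'rV[R]_q with the sup norm. It induces the usual
   topology and the usual (Frechet) differentiability, so the library notions
   are used for these; projections and bounds need the Euclidean structure. *)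
Section Euclidean.
Context {R : realType} {q : nat}.
Implicit Types (x y : 'rV[R]_q) (C : set 'rV[R]_q).

Definition dot x y : R := \sum_j x 0 j * y 0 j.

Definition enorm x : R := Num.sqrt (dot x x).

(* The default value y of xget is irrelevant when C is nonempty, closed and
   convex: the nearest point then exists and is unique. *)
Definition eproj C y : 'rV[R]_q :=
  xget y [set z | C z /\ forall c, C c -> enorm (y - z) <= enorm (y - c)].

Definition gradient (g : 'rV[R]_q -> R) y : 'rV[R]_q :=
  \row_j 'D_(delta_mx 0 j) g y.

Definition C1_on (O : set 'rV[R]_q) (g : 'rV[R]_q -> R) : Prop :=
  forall y, O y -> differentiable g y /\ {for y, continuous (gradient g)}.

(* Solution set of VI(C, G). *)
Definition VI_sol C (G : 'rV[R]_q -> 'rV[R]_q) : set 'rV[R]_q :=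
  [set x | C x /\ forall y, C y -> 0 <= dot (G x) (y - x)].

Definition acute_angle C (G : 'rV[R]_q -> 'rV[R]_q) : Prop :=
  forall x xs, (C `\` VI_sol C G) x -> VI_sol C G xs -> 0 < dot (x - xs) (G x).

End Euclidean.

Section Probability.
Context {R : realType} {d : measure_display} {Omega : measurableType d}.
Variable P : probability Omega R.

Definition borel {T : topologicalType} : set (set T) := <<s open >>.

Definition random_vector {T : topologicalType} (Y : Omega -> T) : Prop :=
  forall B, borel B -> measurable (Y @^-1` B).

Definition mutually_independent {I : eqType} {T : topologicalType}
    (Y : I -> Omega -> T) : Prop :=
  forall (J : seq I) (B : I -> set T), uniq J ->
    (forall j, j \in J -> borel (B j)) ->
    fine (P (\bigcap_(j in [set` J]) (Y j @^-1` B j))) =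
    \prod_(j <- J) fine (P (Y j @^-1` B j)).

(* The values lie in range xi because the costs of the game only have to be
   meaningful there. *)
Definition iid_realizations {I : eqType} {T : topologicalType}
    (xi : Omega -> T) (Y : I -> Omega -> T) : Prop :=
  [/\ forall j, random_vector (Y j),
      forall j w, range xi (Y j w),
      forall j B, borel B -> P (Y j @^-1` B) = P (xi @^-1` B)
    & mutually_independent Y].

(* Z is a version of E[Y | G]. *)
Definition is_cond_exp (G : set (set Omega)) (Y Z : Omega -> R) : Prop :=
  [/\ P.-integrable setT (EFin \o Y),
      P.-integrable setT (EFin \o Z),
      forall B : set R, measurable B -> G (Z @^-1` B)
    & forall A, G A -> (\int[P]_(w in A) (Y w)%:E = \int[P]_(w in A) (Z w)%:E)%E].

End Probability.

(* A profile x = (x_1, ..., x_N) is the concatenation of its blocks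
   x_i = submxrow x i : 'rV_(n i). *)
Notation profile R n := ('rV[R]_(\sum_i n i)).

Section Game.
Context {R : realType} {d : measure_display} {Omega : measurableType d}.
Variable P : probability Omega R.
Context {N m : nat} {n : 'I_N -> nat}.
Variable X : forall i : 'I_N, set 'rV[R]_(n i).
Arguments X : clear implicits.
Variable xi : Omega -> 'rV[R]_m.
(* ft i is the sampled cost of player i. It is a total function, but only
   its values on profiles near X and on range xi are constrained or used. *)
Variable ft : 'I_N -> profile R n -> 'rV[R]_m -> R.

(* (y, x_{-i}) *)
Definition deviate (x : profile R n) (i : 'I_N) (y : 'rV[R]_(n i)) :
    profile R n :=
  \mxrow_j dfwith (fun j => submxrow x j) i y j.

Definition pgrad (g : profile R n -> R) (i : 'I_N) (x : profile R n) :
    'rV[R]_(n i) :=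
  gradient (fun y => g (deviate x y)) (submxrow x i).

Definition joint : set (profile R n) :=
  [set x : profile R n | forall i, X i (submxrow x i)].

Definition cost (i : 'I_N) (x : profile R n) : R :=
  fine 'E_P[fun w => ft i x (xi w)].

(* assumptionA only makes block i of this map continuous in x_i, not jointly
   continuous. *)
Definition pseudograd (x : profile R n) : profile R n :=
  \mxrow_i pgrad (cost i) i x.

Definition QNE : set (profile R n) :=
  [set xs | joint xs /\ forall i (y : 'rV[R]_(n i)), X i y ->
     0 <= dot (pgrad (cost i) i xs) (y - submxrow xs i)].

(* The integrability and differentiability clauses are what makes the
   expectations defining the costs, the gradients of the sampled costs and
   their expectations meaningful. *)
Record assumptionA : Prop := AssumptionA {
  A1_convex : forall i, convex_set (X i);
  A1_closed : forall i, closed (X i);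
  A2_C1 : forall i (x : profile R n),
    (forall j, j != i -> X j (submxrow x j)) ->
    exists O : set 'rV[R]_(n i), [/\ open O, X i `<=` O,
      forall y, O y ->
        P.-integrable setT (EFin \o (fun w => ft i (deviate x y) (xi w)))
    & C1_on O (fun y => cost i (deviate x y))];
  A2_diff : forall i x s, joint x -> range xi s ->
    differentiable (fun y => ft i (deviate x y) s) (submxrow x i);
  A2_grad_int : forall i x (j : 'I_(n i)), joint x ->
    P.-integrable setT (EFin \o (fun w => pgrad (ft i ^~ (xi w)) i x 0 j));
  A2_grad : forall i x, joint x ->
    pgrad (cost i) i x =
    \row_j fine 'E_P[fun w => pgrad (ft i ^~ (xi w)) i x 0 j];
  A3_closed : closed (VI_sol joint pseudograd);
  A3_nonempty : VI_sol joint pseudograd !=set0 }.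

Section Scheme.
Variable gamma : nat -> R.
Variable xis : nat -> 'I_N -> Omega -> 'rV[R]_m.
Variable x : nat -> Omega -> profile R n.

Definition sampled_grad (k : nat) (i : 'I_N) (w : Omega) : 'rV[R]_(n i) :=
  pgrad (ft i ^~ (xis k i w)) i (x k w).

(* The initial point may be random; a deterministic one is a special case. *)
Record SSGR : Prop := Ssgr {
  SSGR_init_meas : random_vector (x 0%N);
  SSGR_init : forall w, joint (x 0%N w);
  SSGR_sample : iid_realizations P xi (fun ki : nat * 'I_N => xis ki.1 ki.2);
  SSGR_step : forall k i w, submxrow (x k.+1 w) i =
    eproj (X i) (submxrow (x k w) i - gamma k *: sampled_grad k i w) }.

Definition history (k : nat) : set (set Omega) :=
  <<s preimage_set_system setT (x 0%N) open `|`
      \bigcup_(t in [set t : nat | (t < k)%N]) \bigcup_(i in [set: 'I_N])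
        preimage_set_system setT (sampled_grad t i) open >>.

Definition noise (k : nat) (w : Omega) : profile R n :=
  \mxrow_i (sampled_grad k i w - pgrad (cost i) i (x k w)).

Record assumptionB : Prop := AssumptionB {
  B1 : forall k j,
    is_cond_exp P (history k) (fun w => noise k w 0 j) (cst 0);
  B2 : exists2 Mw : R, 0 < Mw & forall k,
    exists2 Z : Omega -> R,
      is_cond_exp P (history k) (fun w => enorm (noise k w) ^+ 2) Z
    & {ae P, forall w, Z w <= Mw ^+ 2};
  B3 : exists2 MF : R, 0 < MF & forall y, joint y -> enorm (pseudograd y) <= MF }.

End Scheme.
End Game.

(* Main.v *)
Require Import Defs.
From HB Require Import structures.
From mathcomp Require Import all_boot all_order all_algebra.
From mathcomp Require Import all_classical all_reals all_analysis.
From mathcomp Require Import measurable_realfun ring lra.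

Set Implicit Arguments.
Unset Strict Implicit.
Unset Printing Implicit Defensive.

Import Order.TTheory GRing.Theory Num.Theory.
Import numFieldNormedType.Exports.
Import HBNNSimple.

Local Open Scope classical_set_scope.
Local Open Scope ring_scope.

(** Fix one solution [xs] of the variational inequality and let V k be the
    squared Euclidean distance from the k-th iterate to it.  Projections onto
    convex sets do not increase distances to points of the set, so

      V (k+1) <= V k - 2 g D - 2 g <x k - xs, w k> + g^2 (2 MF^2 + 2 |w k|^2)

    with g the stepsize, w k the noise and D = <x k - xs, F (x k)>
    ([distance_step]).  Two observations turn this into the theorem.

    First, D is nonnegative on all of X.  The acute angle property only says
    this off the solution set; at solutions it follows from convexity of X and
    continuity of F ([acute_ge0]).  Moreover a point of X where D vanishes is a
    solution ([acute_eq0]).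

    Secondly, bounds in expectation suffice, because only a subsequence is
    wanted.  The iterate is a measurable function of the
    history, so the noise is orthogonal to it ([orthogonal_adapted]), and the
    expected recursion telescopes: the expectations of V k and of the sum of
    the g D are bounded uniformly in k ([weighted_bounds]).  As the initial
    point is arbitrary, V 0 need not be integrable; everything is multiplied by
    the weight exp (- V 0), which is positive and known from the start.
    Consider then the sum of g D up to time k plus the g-weighted mean of V up
    to time k.  Its expectation is bounded, so by Fatou's lemma it is almost
    surely bounded along some sequence of times ([often_bounded_ae]).  On such
    an outcome the steps with V bounded carry half of the infinite total
    weight infinitely often while the sum of g D is finite, so D gets
    arbitrarily small at arbitrarily late times at which the iterate stays in
    a fixed ball ([weighted_visits]).  By compactness these iterates cluster at
    a point of X where D vanishes, that is, at a solution ([acute_cluster]);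
    testing the variational inequality with deviations of a single player shows
    that it is a quasi-Nash equilibrium ([VI_sol_QNE]). *)

(** * Euclidean geometry and projections *)

Section EuclideanFacts.
Context {R : realType} {q : nat}.
Implicit Types (x y z c : 'rV[R]_q) (C : set 'rV[R]_q).

Lemma dotC x y : dot x y = dot y x.
Proof. by apply: eq_bigr => j _; rewrite mulrC. Qed.

Lemma dotDl x y z : dot (x + y) z = dot x z + dot y z.
Proof. by rewrite -big_split; apply: eq_bigr => j _; rewrite mxE mulrDl. Qed.

Lemma dotZl (a : R) x y : dot (a *: x) y = a * dot x y.
Proof. by rewrite /dot mulr_sumr; apply: eq_bigr => j _; rewrite mxE mulrA. Qed.

Lemma dotNl x y : dot (- x) y = - dot x y.
Proof. by rewrite -scaleN1r dotZl mulN1r. Qed.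

Lemma dotDr x y z : dot x (y + z) = dot x y + dot x z.
Proof. by rewrite !(dotC x) dotDl. Qed.

Lemma dotZr (a : R) x y : dot x (a *: y) = a * dot x y.
Proof. by rewrite !(dotC x) dotZl. Qed.

Lemma dotNr x y : dot x (- y) = - dot x y.
Proof. by rewrite !(dotC x) dotNl. Qed.

Definition dot_linE := (dotDl, dotDr, dotNl, dotNr, dotZl, dotZr).

Lemma dot_ge0 x : 0 <= dot x x.
Proof. by apply: sumr_ge0 => j _; rewrite -expr2 sqr_ge0. Qed.

Lemma enorm_sqr x : enorm x ^+ 2 = dot x x.
Proof. by rewrite sqr_sqrtr ?dot_ge0. Qed.

Lemma ler_coord_dot x j : x 0 j ^+ 2 <= dot x x.
Proof.
rewrite /dot (bigD1 j)//= -expr2 lerDl.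
by apply: sumr_ge0 => k _; rewrite -expr2 sqr_ge0.
Qed.

(** Equivalence of the sup norm and the Euclidean norm, in the direction that
    transfers Euclidean bounds and limits to the library topology. *)
Lemma mx_norm_le_dot x : `|x| ^+ 2 <= dot x x.
Proof.
have [x0|x0] := eqVneq `|x| 0; first by rewrite x0 expr0n dot_ge0.
have [[i j] /= xij] := mx_norm_neq0 x0.
have -> : `|x| = `|x 0 j| by rewrite -(ord1 i); exact: xij.
by rewrite real_normK ?num_real// ler_coord_dot.
Qed.

Lemma dot_le_sqr x y : `|dot x y| <= (dot x x + dot y y) / 2.
Proof.
have := dot_ge0 (x + y); have := dot_ge0 (x - y); rewrite !dot_linE (dotC y x).
by move=> H1 H2; rewrite ler_norml; apply/andP; split; lra.
Qed.

Lemma dotD_le x y : dot (x + y) (x + y) <= 2 * dot x x + 2 * dot y y.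
Proof. by have := dot_ge0 (x - y); rewrite !dot_linE (dotC y x); lra. Qed.

Lemma dot_step (a : R) x y :
  dot (x - a *: y) (x - a *: y) = dot x x - 2 * a * dot x y + a * a * dot y y.
Proof. by rewrite !dot_linE (dotC y x); ring. Qed.

Lemma cvg_dot {T : Type} {F : set_system T} {FF : Filter F}
    (f g : T -> 'rV[R]_q) (a b : 'rV[R]_q) :
  f t @[t --> F] --> a -> g t @[t --> F] --> b ->
  dot (f t) (g t) @[t --> F] --> dot a b.
Proof.
move=> fa gb; rewrite /dot; apply: cvg_big => [|j _].
  exact: (@add_continuous R^o).
apply: cvgM.
  exact: (cvg_comp _ (fun M : 'rV[R]_q => M 0 j) fa
    (@coord_continuous R 1 q 0 j _)).
exact: (cvg_comp _ (fun M : 'rV[R]_q => M 0 j) gb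
  (@coord_continuous R 1 q 0 j _)).
Qed.

Lemma cvg_subl y : continuous (fun z => y - z).
Proof.
move=> z; apply: (@cvgB R 'rV[R]_q _ _ (nbhs_filter z) (fun=> y) id);
  [exact: cvg_cst|exact: cvg_id].
Qed.

Lemma convex_setE C : convex_set C -> forall x y (t : R),
  C x -> C y -> 0 <= t -> t <= 1 -> C (t *: x + (1 - t) *: y).
Proof.
move=> cC x y t Cx Cy t0 t1.
have := cC x y (Itv01 t0 t1); rewrite !inE => /(_ Cx Cy).
by [].
Qed.

(** Only the points of [C] no farther from [y] than some fixed one compete; they
    form a compact set, on which the distance attains its minimum. *)
Lemma eprojP C y : closed C -> C !=set0 ->
  C (eproj C y) /\
  forall c, C c -> dot (y - eproj C y) (y - eproj C y) <= dot (y - c) (y - c).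
Proof.
move=> clC [c0 Cc0].
have contd : continuous (fun z => dot (y - z) (y - z)).
  by move=> z; exact: (cvg_dot (@cvg_subl y z) (@cvg_subl y z)).
pose K := C `&` [set z | dot (y - z) (y - z) <= dot (y - c0) (y - c0)].
have clK : closed K.
  apply: closedI => //.
  by apply: (@preimage_closed _ _ _ [set r | r <= _]) => [z _|];
    [exact: contd|exact: closed_le].
have bK : bounded_set K.
  rewrite /bounded_set /bounded_near; near=> M => z [Cz]/= zle.
  have : `|y - z| <= 1 + dot (y - c0) (y - c0).
    have := le_trans (mx_norm_le_dot (y - z)) zle.
    by have := normr_ge0 (y - z); have := dot_ge0 (y - c0); nra.
  have : `|z| <= `|y - z| + `|y|.
    by rewrite -(normrN (y - z)) (le_trans _ (ler_normD _ _))// opprB subrK.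
  move=> H1 H2.
  have : `|y| + (1 + dot (y - c0) (y - c0)) <= M.
    near: M; apply: nbhs_pinfty_ge; exact: num_real.
  by lra.
have K0 : K !=set0 by exists c0; split => /=.
have [z /set_mem[Cz zle] zmin] :=
  compact_EVT_min K0 (bounded_closed_compact bK clK)
    (continuous_subspaceT contd).
have exz : exists z, [set z | C z /\
    forall c, C c -> enorm (y - z) <= enorm (y - c)] z.
  exists z; split=> // c Cc; rewrite ler_sqrt ?dot_ge0//.
  have [cle|/ltW lec] := leP (dot (y - c) (y - c)) (dot (y - c0) (y - c0)).
    by apply: zmin; apply/mem_set; split.
  exact: le_trans zle lec.
have [Cp pmin] := xgetPex y exz; split=> // c Cc.
by rewrite -!enorm_sqr lerXn2r ?nnegrE ?sqrtr_ge0 ?pmin.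
Unshelve. all: by end_near. Qed.

(** First-order optimality of the nearest point: otherwise a small step from
    it towards [c] would get closer to [y]. *)
Lemma eproj_obtuse C y c : closed C -> convex_set C -> C c ->
  dot (y - eproj C y) (c - eproj C y) <= 0.
Proof.
move=> clC cC Cc; have [Cp pmin] := @eprojP C y clC (ex_intro _ c Cc).
set p := eproj C y in Cp pmin *; rewrite leNgt; apply/negP => s0.
set s := dot _ _ in s0; pose M := dot (c - p) (c - p).
have M0 : 0 <= M by exact: dot_ge0.
(* This step length makes the quadratic term t * M smaller than s. *)
pose t := s / (M + s).
have t0 : 0 < t by rewrite divr_gt0//; lra.
have tE : t * (M + s) = s by rewrite /t mulfVK//; lra.
have t1 : t <= 1 by rewrite ler_pdivrMr; lra.
have := pmin _ (convex_setE cC Cc Cp (ltW t0) t1).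
have -> : y - (t *: c + (1 - t) *: p) = (y - p) - t *: (c - p).
  by apply/rowP => j; rewrite !mxE; ring.
rewrite (dotDl (y - p)) !(dotDr _ (y - p)) !dotNl !dotNr !dotZl !dotZr.
rewrite (dotC (c - p) (y - p)) -/s -/M => H.
have : t * (2 * s - t * M) <= 0 by lra.
rewrite pmulr_rle0//; nra.
Qed.

Lemma eproj_nonexpansive C y z : closed C -> convex_set C -> C !=set0 ->
  dot (eproj C y - eproj C z) (eproj C y - eproj C z) <= dot (y - z) (y - z).
Proof.
move=> clC cC C0.
have [Cp _] := @eprojP C y clC C0; have [Cq _] := @eprojP C z clC C0.
have := eproj_obtuse y clC cC Cq; have := eproj_obtuse z clC cC Cp.
set p := eproj C y; set r := eproj C z => H1 H2.
have := dot_ge0 ((y - p) - (z - r)).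
move: H1 H2; rewrite !dot_linE.
rewrite (dotC z y) (dotC p y) (dotC r y) (dotC p z) (dotC r z) (dotC r p).
lra.
Qed.

Lemma eproj_id C y : closed C -> C y -> eproj C y = y.
Proof.
move=> clC Cy; have [_ /(_ _ Cy)] := @eprojP C y clC (ex_intro _ y Cy).
rewrite subrr {2}/dot big1 => [|j _]; last by rewrite mxE mul0r.
move=> /(le_trans (mx_norm_le_dot _)); rewrite real_exprn_even_le0 ?num_real//=.
by rewrite normr_eq0 subr_eq0 => /eqP.
Qed.

Lemma eproj_dist C y c : closed C -> convex_set C -> C c ->
  dot (eproj C y - c) (eproj C y - c) <= dot (y - c) (y - c).
Proof.
move=> clC cC Cc; rewrite -{1 2}(eproj_id clC Cc).
by apply: eproj_nonexpansive => //; exists c.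
Qed.

Lemma eproj_continuous C : closed C -> convex_set C -> C !=set0 ->
  continuous (eproj C).
Proof.
move=> clC cC C0 y; apply/(@cvgrPdist_lt _ _ _ _ (nbhs_filter y)) => e e0.
have dle : dot (y - z) (y - z) @[z --> y] --> (0 : R).
  have -> : 0 = dot (y - y) (y - y).
    by rewrite subrr /dot big1// => j _; rewrite mxE mul0r.
  by exact: (cvg_dot (@cvg_subl y y) (@cvg_subl y y)).
have e20 : 0 < e ^+ 2 by rewrite exprn_gt0.
have := (@cvgr0Pnorm_lt R R^o _ _ (nbhs_filter y) _).1 dle _ e20.
apply: filterS => z zlt.
rewrite -(@ltr_pXn2r _ 2)// ?nnegrE ?(ltW e0)//.
apply: le_lt_trans (mx_norm_le_dot _) _.
apply: le_lt_trans (eproj_nonexpansive y z clC cC C0) _.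
exact: le_lt_trans (ler_norm _) zlt.
Qed.

End EuclideanFacts.

(** * Measurability of random vectors *)

Section RandomVectors.
Context {R : realType} {q : nat}.

Lemma measurable_coord d (T : measurableType d) (Y : T -> 'rV[R]_q) j :
  (forall U, open U -> measurable (Y @^-1` U)) ->
  measurable_fun setT (fun w => Y w 0 j).
Proof.
move=> mY; apply: (measurability _ (RGenOInfty.measurableE R)) => //.
move=> /= _ [_ [a ->] <-]; rewrite preimage_itvoy setTI.
apply: (mY [set v : 'rV[R]_q | a < v 0 j]).
apply: (@open_comp _ _ (fun v : 'rV[R]_q => v 0 j) [set r | a < r]).
  by move=> z _; exact: coord_continuous.
exact: open_gt.
Qed.

(** An open set is the union of the boxes with rational centre and radius
    1 / (k + 1) that it contains, and there are countably many of these. *)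
Lemma measurable_vector d (T : measurableType d) (Y : T -> 'rV[R]_q) U :
  (forall j, measurable_fun setT (fun w => Y w 0 j)) -> open U ->
  measurable (Y @^-1` U).
Proof.
move=> mY oU.
pose box (ck : {ffun 'I_q -> rat} * nat) : set 'rV[R]_q :=
  [set v | forall j, `|v 0 j - ratr (ck.1 j)| < ck.2.+1%:R^-1].
pose F ck := if `[< box ck `<=` U >] then Y @^-1` box ck else set0.
have -> : Y @^-1` U = \bigcup_ck F ck.
  apply/seteqP; split=> [w /= Uw|w [ck _]]; last first.
    by rewrite /F; case: ifPn => // /asboolP bU /bU.
  have [e /= e0 eU] := (nbhs_ballP _ _).1 (open_nbhs_nbhs (conj oU Uw)).
  have [k ke] : exists k : nat, k.+1%:R^-1 < e / 2.
    exists (Num.truncn (e / 2)^-1); rewrite invf_plt ?posrE ?divr_gt0//.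
    exact: truncnS_gt.
  have k0 : (0 : R) < k.+1%:R^-1 by rewrite invr_gt0.
  have {k0} := k0; have {ke} := ke.
  move eqd : (k.+1%:R^-1 : R) => del ke k0.
  have /choice[c cP] (j : 'I_q) : exists r : rat,
      `|Y w 0 j - ratr r| < del.
    have [|r] := @rat_in_itvoo R (Y w 0 j - del) (Y w 0 j).
      by lra.
    rewrite in_itv/= => /andP[r1 r2]; exists r.
    by rewrite ger0_norm; lra.
  exists ([ffun j => c j], k) => //; rewrite /F asboolT /=.
    by move=> j; rewrite ffunE eqd.
  move=> v /= vP; apply: eU; split=> // i j; rewrite (ord1 i).
  have := vP j; rewrite ffunE /= eqd => vj; have cj := cP j.
  apply: le_lt_trans (ler_distD (ratr (c j)) _ _) _.
  by rewrite (distrC (ratr (c j))); lra.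
apply: countable_bigcupT_measurable => [|ck]; first exact: countableP.
rewrite /F; case: ifP => // _.
have -> : Y @^-1` box ck = \bigcap_(j in [set: 'I_q])
    ((fun w => Y w 0 j) @^-1` ball (ratr (ck.1 j) : R) ck.2.+1%:R^-1).
  apply/seteqP; split=> w /=.
    by move=> H j _ /=; rewrite -ball_normE /ball_ /= distrC; exact: H.
  by move=> H j; have := H j I; rewrite /= -ball_normE /ball_ /= distrC.
apply: fin_bigcap_measurable => // j _.
have := mY j measurableT _ (measurable_ball (ratr (ck.1 j) : R) ck.2.+1%:R^-1).
by rewrite setTI.
Qed.

End RandomVectors.

(** * Orthogonality of noise to the past *)

Section Orthogonality.
Context {R : realType} d (T : measurableType d).
Variable P : {measure set T -> \bar R}.
Variable H : set (set T).
Hypothesis sub_meas : <<s H >> `<=` @measurable _ T.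

Local Notation adapted f :=
  (@measurable_fun _ _ (g_sigma_algebraType H) _ setT f).

Lemma adapted_measurable d' (T' : measurableType d') (f : T -> T') :
  adapted f -> measurable_fun setT f.
Proof. by move=> mf _ B mB; apply: sub_meas; apply: mf. Qed.

(** A nonnegative adapted factor is an increasing limit of simple functions
    over the small sigma-algebra, against which [w] integrates to zero term by
    term; the product dominates the approximants. *)
Lemma orthogonal_ge0 (w Y : T -> R) :
  P.-integrable setT (EFin \o w) ->
  (forall A, <<s H >> A -> (\int[P]_(t in A) (w t)%:E = 0)%E) ->
  adapted Y -> (forall t, 0 <= Y t) ->
  P.-integrable setT (fun t => (Y t * w t)%:E) ->
  (\int[P]_t (Y t * w t)%:E = 0)%E.
Proof.
move=> iw w0 mY Y0 iYw.
have mEY : @measurable_fun _ _ (g_sigma_algebraType H) _ setT (EFin \o Y).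
  exact/measurable_EFinP.
pose g := nnsfun_approx (@measurableT _ (g_sigma_algebraType H)) mEY.
have gY t : (fun k => (g k t : R)) @ \oo --> Y t.
  have /= := @cvg_nnsfun_approx _ _ _ _ measurableT _ mEY
    (fun t _ => Y0 t) t Logic.I.
  by move=> /fine_cvgP[_].
have ndg t : nondecreasing_seq (fun k => (g k t : R)).
  by move=> i j ij; exact/lefP/nd_nnsfun_approx.
have leg k t : g k t <= Y t.
  rewrite -(cvg_lim _ (gY t))//; apply: nondecreasing_cvgn_le (ndg t) _ k.
  by apply/cvg_ex; exists (Y t).
have mw : measurable_fun setT w by exact/measurable_EFinP/(measurable_int P).
have mg k : measurable_fun setT (g k : T -> R).
  exact: adapted_measurable.
have [||||| _ _ cvgI] := @dominated_convergence _ _ _ P setT measurableT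
    (fun k t => (g k t * w t)%:E) (fun t => (Y t * w t)%:E)
    (abse \o (fun t => (Y t * w t)%:E)).
- by move=> k; apply/measurable_EFinP; exact: measurable_funM.
- exact: measurable_int iYw.
- apply: aeW => t _; apply: cvg_EFin; first by apply: nearW.
  by apply: cvgM; [exact: gY|exact: cvg_cst].
- exact: integrable_abse.
- apply: aeW => t k _ /=; rewrite lee_fin !normrM ler_wpM2r//.
  by rewrite !ger0_norm//; exact: leg.
have {}cvgI : (\int[P]_t (g k t * w t)%:E @[k --> \oo] -->
    \int[P]_t (Y t * w t)%:E)%E := cvgI.
rewrite -(cvg_lim _ cvgI)//.
suff -> : (fun k => \int[P]_t (g k t * w t)%:E)%E = cst 0%E by exact: lim_cst.
apply/funext => k /=.
have mA r : <<s H >> (g k @^-1` [set r]).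
  have := measurable_funPTI (g k) (measurable_set1 r).
  by [].
have mA' r : @measurable d T (g k @^-1` [set r]) by exact: sub_meas.
have iA r : P.-integrable setT (fun t => (\1_(g k @^-1` [set r]) t * w t)%:E).
  apply: le_integrable iw => //.
    by apply/measurable_EFinP; apply: measurable_funM => //;
      exact: measurable_indic.
  move=> t _ /=; rewrite lee_fin normrM ler_piMl// indicE.
  by case: (_ \in _); rewrite ?normr1 ?normr0.
under eq_integral => t _.
  rewrite (fimfunEord (g k)) mulr_suml -sumEFin.
  under eq_bigr do rewrite -mulrA EFinM.
  over.
rewrite integral_sum//; last by move=> i; exact: integrableZl.
rewrite big1// => i _; rewrite integralZl//.
set r := nth _ _ _.
have -> : (\int[P]_t (\1_(g k @^-1` [set r]) t * w t)%:E =
    \int[P]_(t in g k @^-1` [set r]) (w t)%:E)%E.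
  rewrite [RHS]integral_mkcond; apply: eq_integral => t _.
  by rewrite patchE indicE; case: ifP => _; rewrite ?mul1r ?mul0r.
by rewrite w0 ?mule0//; exact: mA.
Qed.

(** The product need only be integrable as a whole, so that unbounded adapted
    factors such as the distance to a solution are covered. *)
Lemma orthogonal_adapted (w Y : T -> R) :
  P.-integrable setT (EFin \o w) ->
  (forall A, <<s H >> A -> (\int[P]_(t in A) (w t)%:E = 0)%E) ->
  adapted Y ->
  P.-integrable setT (fun t => (Y t * w t)%:E) ->
  (\int[P]_t (Y t * w t)%:E = 0)%E.
Proof.
move=> iw w0 mY iYw.
have mw : measurable_fun setT w by exact/measurable_EFinP/(measurable_int P).
have ip (Z : T -> R) : adapted Z -> (forall t, `|Z t| <= `|Y t|) ->
    P.-integrable setT (fun t => (Z t * w t)%:E).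
  move=> mZ ZY; apply: le_integrable iYw => //.
    apply/measurable_EFinP; apply: measurable_funM => //.
    exact: adapted_measurable.
  by move=> t _ /=; rewrite lee_fin !normrM ler_wpM2r.
pose Yp t := Num.max (Y t) 0; pose Yn t := Num.max (- Y t) 0.
have mYp : adapted Yp.
  exact: (@measurable_maxr _ (g_sigma_algebraType H)).
have mYn : adapted Yn.
  apply: (@measurable_maxr _ (g_sigma_algebraType H)) => //.
  exact: (@measurableT_comp _ _ _ (g_sigma_algebraType H)).
have iYp : P.-integrable setT (fun t => (Yp t * w t)%:E).
  by apply: ip mYp _ => t; rewrite /Yp; case: (leP (Y t) 0) => _; rewrite ?normr0.
have iYn : P.-integrable setT (fun t => (Yn t * w t)%:E).
  by apply: ip mYn _ => t; rewrite /Yn; case: (leP (- Y t) 0) => _;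
      rewrite ?normr0 ?normrN.
have -> : (\int[P]_t (Y t * w t)%:E =
    \int[P]_t ((Yp t * w t)%:E - (Yn t * w t)%:E))%E.
  apply: eq_integral => t _; rewrite -EFinB -mulrBl; congr (_ * _)%:E.
  by rewrite /Yp /Yn; case: (leP (Y t) 0); case: (leP (- Y t) 0); lra.
rewrite integralB// !orthogonal_ge0 ?sube0// => t; rewrite ?/Yp ?/Yn.
  by rewrite le_max lexx orbT.
by rewrite le_max lexx orbT.
Qed.

End Orthogonality.

(** * Profiles and their blocks *)

Section Blocks.
Context {R : realType} {N : nat} {n : 'I_N -> nat}.
Implicit Types (x y : profile R n).

Lemma dot_submxrow x y :
  dot x y = \sum_i dot (submxrow x i) (submxrow y i).
Proof.
rewrite /dot sig_big_dep/= (reindex _ tagnat.sig_bij_on)/=.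
apply: eq_bigr => j _; rewrite !mxE.
have -> : tagnat.Rank (tag (tagnat.sig j)) (tagged (tagnat.sig j)) = j.
  exact: tagnat.sig2K.
by [].
Qed.

Lemma submxrow_deviate x i (y : 'rV[R]_(n i)) j :
  submxrow (deviate x y) j = dfwith (fun j => submxrow x j) i y j.
Proof. by rewrite mxrowK. Qed.

(** Testing a variational inequality on a product set with a profile that
    differs from the solution in one block only isolates that player. *)
Lemma dot_deviate (u x : profile R n) i (y : 'rV[R]_(n i)) :
  dot u (deviate x y - x) = dot (submxrow u i) (y - submxrow x i).
Proof.
rewrite dot_submxrow (bigD1 i)//= [X in _ + X]big1 => [|j ji].
  by rewrite [LHS]addr0 submxrowB submxrow_deviate dfwithin.
rewrite submxrowB submxrow_deviate dfwithout 1?eq_sym// subrr.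
by rewrite /dot big1// => k _; rewrite [X in _ * X]mxE mulr0.
Qed.

Lemma joint_closed (X : forall i, set 'rV[R]_(n i)) :
  (forall i, closed (X i)) -> closed (joint X).
Proof.
move=> clX x clx i; apply: clX => B nB.
have sub_cont : continuous (fun z : profile R n => submxrow z i).
  move=> z; apply/(@cvgrPdist_lt _ _ _ _ (nbhs_filter z)) => e e0.
  apply/nbhs_ballP; exists e => // v [_ vz].
  have : ball (submxrow z i) e (submxrow v i).
    by split=> // k j; rewrite !mxE; exact: vz.
  by rewrite mx_norm_ball.
have [z [Xz Bz]] := clx _ (sub_cont x _ nB).
by exists (submxrow z i); split.
Qed.

Lemma joint_convex (X : forall i, set 'rV[R]_(n i)) x y (t : R) :
  (forall i, convex_set (X i)) -> joint X x -> joint X y ->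
  0 <= t -> t <= 1 -> joint X (t *: x + (1 - t) *: y).
Proof.
move=> cX Xx Xy t0 t1 i.
have -> : submxrow (t *: x + (1 - t) *: y) i =
    t *: submxrow x i + (1 - t) *: submxrow y i.
  by apply/rowP => j; rewrite !mxE.
exact: convex_setE.
Qed.

End Blocks.

(** * Variational inequalities with the acute angle property *)

Section AcuteAngle.
Context {R : realType} {q : nat}.
Variables (C : set 'rV[R]_q) (G : 'rV[R]_q -> 'rV[R]_q).
Hypothesis C_convex : forall x y (t : R), C x -> C y -> 0 <= t -> t <= 1 ->
  C (t *: x + (1 - t) *: y).
Hypothesis G_cont : {within C, continuous G}.
Hypothesis G_acute : acute_angle C G.

Lemma within_cvg x : C x -> G @ within C (nbhs x) --> G x.
Proof.
move=> Cx A nA; have := @G_cont x A nA.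
by rewrite /nbhs /= -(nbhs_subspace_in Cx).
Qed.

(** The acute angle property says nothing at solutions.  If the inner product
    were negative at a solution [x], then by continuity it would be negative at
    nearby points of the segment towards [xs], which would therefore be
    solutions too; testing their variational inequality with [x] is
    contradictory. *)
Lemma acute_ge0 x xs : C x -> VI_sol C G xs -> 0 <= dot (x - xs) (G x).
Proof.
move=> Cx sxs; have Cxs := sxs.1; rewrite leNgt; apply/negP => neg.
have cvD : dot (x - xs) (G y) @[y --> within C (nbhs x)] --> dot (x - xs) (G x).
  by apply: cvg_dot; [exact: cvg_cst|exact: within_cvg].
have := cvD _ (open_nbhs_nbhs (conj (@open_lt R 0) neg)).
rewrite /= /within /= => /nbhs_ballP[e /= e0 eD].
(* A step short enough to stay within distance e of x, yet smaller than 1. *)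
pose t := (e / (`|x - xs| + e)) / 2.
have n0 : 0 <= `|x - xs| by exact: normr_ge0.
have t0 : 0 < t by rewrite !divr_gt0//; lra.
have tE : 2 * t * (`|x - xs| + e) = e.
  by rewrite /t; field; rewrite gt_eqF//; lra.
have t12 : t < 1.
  by rewrite /t -mulrA -invfM ltr_pdivrMr; nra.
pose z := (1 - t) *: x + t *: xs.
have Cz : C z.
  rewrite /z; have := @C_convex xs x t Cxs Cx; rewrite addrC; apply; lra.
have zx : x - z = t *: (x - xs) by apply/rowP => j; rewrite !mxE; ring.
have zxs : z - xs = (1 - t) *: (x - xs) by apply/rowP => j; rewrite !mxE; ring.
have Dz : dot (x - xs) (G z) < 0.
  apply: eD => //; rewrite mx_norm_ball /ball_ /= zx normrZ gtr0_norm//; nra.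
have sz : VI_sol C G z.
  apply: contrapT => nsz; have := G_acute (conj Cz nsz) sxs.
  by rewrite zxs dotZl pmulr_rgt0 ?subr_gt0// ltNge (ltW Dz).
by have := sz.2 _ Cx; rewrite zx dotZr dotC pmulr_rge0// leNgt Dz.
Qed.

Lemma acute_eq0 x xs : C x -> VI_sol C G xs -> dot (x - xs) (G x) <= 0 ->
  VI_sol C G x.
Proof.
move=> Cx sxs D0; apply: contrapT => nsx.
by have := G_acute (conj Cx nsx) sxs; rewrite ltNge D0.
Qed.

Lemma strict_subseq (u : nat -> 'rV[R]_q) l :
  (forall e K, 0 < e -> exists2 k, (K <= k)%N & `|l - u k| < e) ->
  exists2 s : nat -> nat, {homo s : a b / (a < b)%N} &
    u (s k) @[k --> \oo] --> l.
Proof.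
move=> freq.
have /choice[f fP] (jK : nat * nat) : exists k : nat,
    (jK.2 <= k)%N /\ `|l - u k| < jK.1.+1%:R^-1.
  have [|k k1 k2] := freq jK.1.+1%:R^-1 jK.2; first by rewrite invr_gt0.
  by exists k.
pose fix s (j : nat) : nat :=
  if j is j'.+1 then f (j, (s j').+1) else f (0%N, 0%N).
exists s.
  by apply: homo_ltn => [|j]; [exact: ltn_trans|have [] := fP (j.+1, (s j).+1)].
have sl j : `|l - u (s j)| < j.+1%:R^-1.
  by case: j => [|j]; [have [] := fP (0%N, 0%N)|have [] := fP (j.+1, (s j).+1)].
apply/(@cvgrPdist_lt R 'rV[R]_q) => e e0.
exists (Num.truncn e^-1) => // j /= jge.
apply: lt_trans (sl j) _; rewrite invf_plt ?posrE//.
apply: lt_le_trans (truncnS_gt _) _.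
by rewrite ler_nat ltnS.
Qed.

(** The selected terms lie in a compact set, and at their cluster points the
    inner product is zero because it is continuous on [C]; by the acute angle
    property such a point is a solution. *)
Lemma acute_cluster (u : nat -> 'rV[R]_q) xs (W : R) : closed C ->
  VI_sol C G xs -> (forall k, C (u k)) ->
  (forall e K, 0 < e -> exists k, [/\ (K <= k)%N,
     dot (u k - xs) (u k - xs) <= W & dot (u k - xs) (G (u k)) < e]) ->
  exists (s : nat -> nat) l, [/\ {homo s : a b / (a < b)%N},
    VI_sol C G l & u (s k) @[k --> \oo] --> l].
Proof.
move=> clC sxs Cu freq.
have /choice[f fP] (j : nat) : exists k, [/\ (j <= k)%N,
     dot (u k - xs) (u k - xs) <= W & dot (u k - xs) (G (u k)) < j.+1%:R^-1].
  by apply: freq; rewrite invr_gt0.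
pose B := C `&` [set y | `|y - xs| <= W + 1].
have cB : compact B.
  apply: bounded_closed_compact.
    rewrite /bounded_set /bounded_near; near=> M => y [_ /= yW].
    have : `|y| <= `|y - xs| + `|xs| by rewrite -{1}(subrK xs y) ler_normD.
    have : W + 1 + `|xs| <= M.
      by near: M; apply: nbhs_pinfty_ge; exact: num_real.
    by lra.
  apply: closedI => //.
  apply: (@preimage_closed _ _ (fun y : 'rV[R]_q => `|y - xs|) [set r | r <= _]).
    move=> y _.
    have c : (fun y => y - xs) z @[z --> y] --> y - xs.
      by apply: (@cvgB R 'rV[R]_q _ _ (nbhs_filter y) id (fun=> xs));
        [exact: cvg_id|exact: cvg_cst].
    exact: (cvg_norm (FF := nbhs_filter y) c).
  exact: closed_le.
have uB j : B (u (f j)).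
  split; [exact: Cu|have [_ uW _] := fP j].
  have := le_trans (mx_norm_le_dot _) uW.
  by have := normr_ge0 (u (f j) - xs); rewrite /=; nra.
have uBn : ((u \o f) @ \oo) B by exists 0%N => // j _; exact: uB.
have [l [Bl cl]] := cB _ _ uBn.
have freq_l (A : set 'rV[R]_q) K : nbhs l A -> exists2 j, (K <= j)%N & A (u (f j)).
  move=> nA.
  have [|_ [[j Kj <-] Aj]] := cl [set u (f j) | j in [set j | (K <= j)%N]] A _ nA.
    by exists K => // j /= Kj; exists j.
  by exists j.
have sl : VI_sol C G l.
  apply: (acute_eq0 Bl.1 sxs); rewrite leNgt; apply/negP => D0.
  set D := dot _ _ in D0.
  have cvD : dot (y - xs) (G y) @[y --> within C (nbhs l)] --> D.
    apply: cvg_dot; last exact: within_cvg Bl.1.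
    apply: (@cvgB R 'rV[R]_q _ _ _ id (fun=> xs)); last exact: cvg_cst.
    exact: cvg_within.
  have Dlt : D / 2 < D by lra.
  have nD := cvD _ (open_nbhs_nbhs (conj (@open_gt R (D / 2)) Dlt)).
  have [j Kj] := freq_l _ (Num.truncn (D / 2)^-1) nD.
  move=> /(_ (Cu _)) /=; have [_ _] := fP j.
  have : (j.+1%:R^-1 : R) < D / 2.
    rewrite invf_plt ?posrE ?divr_gt0//.
    by apply: lt_le_trans (truncnS_gt _) _; rewrite ler_nat ltnS.
  by move=> /ltW H1 /lt_le_trans/(_ H1) H2 /(lt_trans H2); rewrite ltxx.
have [|s s1 s2] := @strict_subseq u l; last by exists s, l.
move=> e K e0; have [j Kj jP] := freq_l _ K (nbhsx_ballx l e e0).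
exists (f j); first by apply: leq_trans Kj _; have [] := fP j.
by move: jP; rewrite mx_norm_ball.
Unshelve. all: by end_near. Qed.

End AcuteAngle.

(** * Divergent and summable stepsizes *)

Lemma partial_sums_le {R : realType} (u : nat -> R) : (forall k, 0 <= u k) ->
  (\sum_(0 <= k <oo) (u k)%:E < +oo)%E ->
  exists G, forall k, \sum_(0 <= j < k) u j <= G.
Proof.
move=> u0 fin; exists (fine (\sum_(0 <= k <oo) (u k)%:E)%E) => k.
have s0 : (0 <= \sum_(0 <= k <oo) (u k)%:E)%E.
  by apply: nneseries_ge0 => j _ _; rewrite lee_fin.
rewrite -lee_fin fineK ?ge0_fin_numE// -sumEFin.
by apply: nneseries_lim_ge => j _ _; rewrite lee_fin.
Qed.

Lemma partial_sums_unbounded {R : realType} (u : nat -> R) :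
  (forall k, 0 <= u k) -> (\sum_(0 <= k <oo) (u k)%:E = +oo)%E ->
  forall A, exists n0, forall k, (n0 <= k)%N -> A < \sum_(0 <= j < k) u j.
Proof.
move=> u0 inf A.
have [n0 An0] : exists n0, A < \sum_(0 <= j < n0) u j.
  apply: contrapT => none.
  have : (\sum_(0 <= k <oo) (u k)%:E <= A%:E)%E.
    apply: lime_le; first by apply: is_cvg_nneseries => j _ _; rewrite lee_fin.
    apply: nearW => k; rewrite sumEFin lee_fin leNgt; apply/negP => Ak.
    by apply: none; exists k.
  by rewrite inf.
exists n0 => k n0k; apply: lt_le_trans An0 _.
by rewrite [leRHS](big_cat_nat (n := n0))//= lerDl sumr_ge0.
Qed.

(** By Markov's inequality the steps with V k <= 2 L carry, infinitely often, at
    least half of the total weight.  This total diverges, so [D], whose weighted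
    sum is finite, cannot be bounded away from zero on those steps. *)
Lemma weighted_visits {R : realType} (gam D V : nat -> R) (L : R) :
  (forall k, 0 <= gam k) -> (forall k, 0 <= D k) -> (forall k, 0 <= V k) ->
  (forall A, exists n0, forall n, (n0 <= n)%N -> A < \sum_(0 <= k < n) gam k) ->
  0 < L ->
  (forall n0, exists n, [/\ (n0 <= n)%N,
     \sum_(0 <= k < n) gam k * D k <= L &
     \sum_(0 <= k < n) gam k * V k <= L * \sum_(0 <= k < n) gam k]) ->
  forall e K, 0 < e -> exists k, [/\ (K <= k)%N, V k <= 2 * L & D k < e].
Proof.
move=> gam0 D0 V0 div L0 often e K e0; apply: contrapT => none.
have bnd k : (K <= k)%N ->
    gam k <= (2 * L)^-1 * (gam k * V k) + e^-1 * (gam k * D k).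
  move=> Kk; have g := gam0 k.
  have i1 : 0 <= (2 * L)^-1 * (gam k * V k).
    by rewrite mulr_ge0 ?invr_ge0 ?mulr_ge0//; lra.
  have i2 : 0 <= e^-1 * (gam k * D k) by rewrite mulr_ge0 ?invr_ge0 ?mulr_ge0// ltW.
  have [Vk|Vk] := leP (V k) (2 * L).
    have Dk : e <= D k by rewrite leNgt; apply/negP => Dk; apply: none; exists k.
    apply: ler_wpDl => //; rewrite mulrCA ler_peMr//.
    by rewrite mulrC ler_pdivlMr// mul1r.
  apply: ler_wpDr => //; rewrite mulrCA ler_peMr//.
  by rewrite mulrC ler_pdivlMr ?mul1r ?ltW//; lra.
pose S n := \sum_(0 <= k < n) gam k.
have [n0 n0P] := div (2 * (S K + e^-1 * L)).
have [n [nn HD HV]] := often (maxn n0 K).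
move: nn; rewrite geq_max => /andP[/n0P Sn Kn].
have : S n - S K <= (2 * L)^-1 * (L * S n) + e^-1 * L.
  have -> : S n - S K = \sum_(K <= k < n) gam k.
    by apply/eqP; rewrite subr_eq addrC /S [eqbLHS](big_cat_nat (n := K)).
  apply: (@le_trans _ _ ((2 * L)^-1 * (\sum_(0 <= k < n) gam k * V k) +
      e^-1 * (\sum_(0 <= k < n) gam k * D k))); last first.
    by apply: lerD; apply: ler_wpM2l; rewrite ?invr_ge0//; lra.
  rewrite !mulr_sumr -big_split/=.
  apply: (@le_trans _ _ (\sum_(K <= k < n)
      ((2 * L)^-1 * (gam k * V k) + e^-1 * (gam k * D k)))).
    by rewrite !big_nat; apply: ler_sum => k /andP[Kk _]; exact: bnd.
  rewrite [leRHS](big_cat_nat (n := K))//= lerDr; apply: sumr_ge0 => k _.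
  by apply: addr_ge0; rewrite mulr_ge0 ?invr_ge0 ?mulr_ge0//; lra.
have -> : (2 * L)^-1 * (L * S n) = S n / 2.
  by field; lra.
by rewrite -/(S n) in Sn; lra.
Qed.

(** * Integral estimates *)

(** Fatou's lemma: the lower limit has a finite integral, hence is finite almost
    everywhere. *)
Lemma ae_often_bounded {R : realType} d (T : measurableType d)
    (P : {measure set T -> \bar R}) (f : nat -> T -> R) (C : R) :
  (forall k, measurable_fun setT (f k)) -> (forall k t, 0 <= f k t) ->
  (forall k, (\int[P]_t (f k t)%:E <= C%:E)%E) ->
  {ae P, forall t, exists L, forall n0, exists2 k, (n0 <= k)%N & f k t <= L}.
Proof.
move=> mf f0 fC.
have mF k : measurable_fun setT (fun t => (f k t)%:E) by exact/measurable_EFinP.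
have mli : measurable_fun setT (fun t => limn_einf (fun k => (f k t)%:E)).
  apply: measurableT_comp => //.
  by apply: measurable_fun_limn_esup => k; exact: measurableT_comp.
have li0 t : (0 <= limn_einf (fun k => (f k t)%:E))%E.
  rewrite limn_einf_lim; apply: lime_ge; first exact: is_cvg_einfs.
  apply: nearW => k; apply: le_ereal_inf_tmp => _ [j /= _ <-].
  by rewrite lee_fin.
have Ifin : (\int[P]_t limn_einf (fun k => (f k t)%:E) <= C%:E)%E.
  apply: le_trans (fatou P measurableT mF _) _.
    by move=> k t _; rewrite lee_fin.
  rewrite limn_einf_lim; apply: lime_le; first exact: is_cvg_einfs.
  apply: nearW => k; apply: le_trans (fC k); apply: ge_ereal_inf.
  by exists (\int[P]_t (f k t)%:E)%E => //; exists k => /=.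
have : P.-integrable setT (fun t => limn_einf (fun k => (f k t)%:E)).
  apply/integrableP; split => //.
  under eq_integral do rewrite gee0_abs//.
  exact: le_lt_trans Ifin (ltry _).
move=> /(integrable_ae measurableT); apply: filterS => t /(_ I).
set u := fun k => (f k t)%:E => ufin.
exists (fine (limn_einf u) + 1) => n0.
have : (einfs u n0 < (fine (limn_einf u) + 1)%:E)%E.
  rewrite EFinD fineK//; apply: (@le_lt_trans _ _ (limn_einf u)).
    rewrite limn_einf_lim (cvg_lim _ (@cvg_einfs_sup _ u))//.
    by apply: le_ereal_sup_tmp; exists (einfs u n0) => //; exists n0.
  by rewrite lteDl// lte01.
move=> /ereal_inf_lt[_ [k /= n0k <-]]; rewrite lte_fin => /ltW fk.
by exists k.
Qed.

Lemma Rintegral_probability_cst {R : realType} d (T : measurableType d)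
    (P : probability T R) (r : R) : \int[P]_(_ in setT) r = r.
Proof.
rewrite Rintegral_cst// -[RHS]mulr1; congr (_ * _).
by rewrite -[RHS]/(fine 1%E); congr fine; exact: probability_setT.
Qed.

(** Integrating a one-step descent inequality whose cross term [c] has zero
    mean; the bound itself shows that the next value [a'] is integrable. *)
Lemma Rintegral_descent {R : realType} d (T : measurableType d)
    (P : probability T R) (a a' b c e : T -> R) (g K M : R) :
  P.-integrable setT (EFin \o a) -> P.-integrable setT (EFin \o b) ->
  P.-integrable setT (EFin \o c) -> P.-integrable setT (EFin \o e) ->
  measurable_fun setT a' -> (forall t, 0 <= a' t) ->
  \int[P]_t c t = 0 -> \int[P]_t e t <= M ->
  (forall t, a' t <= a t - 2 * g * b t - 2 * g * c t + g ^+ 2 * (K + 2 * e t)) ->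
  P.-integrable setT (EFin \o a') /\
  \int[P]_t a' t + 2 * g * \int[P]_t b t <= \int[P]_t a t + g ^+ 2 * (K + 2 * M).
Proof.
move=> ia ib ic ie ma' a'0 c0 eM desc.
have iZ (f : T -> R) r : P.-integrable setT (EFin \o f) ->
    P.-integrable setT (EFin \o (fun t => r * f t)).
  by move=> fi; exact: (integrableZl measurableT r fi).
have iK : P.-integrable setT (EFin \o (fun=> g ^+ 2 * K)).
  by apply: finite_measure_integrable_cst.
have iab : P.-integrable setT (EFin \o (fun t => a t - 2 * g * b t)).
  exact: (integrableB measurableT ia (iZ _ (2 * g) ib)).
have iabc : P.-integrable setT
    (EFin \o (fun t => a t - 2 * g * b t - 2 * g * c t)).
  exact: (integrableB measurableT iab (iZ _ (2 * g) ic)).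
have iKe : P.-integrable setT
    (EFin \o (fun t => g ^+ 2 * K + g ^+ 2 * 2 * e t)).
  exact: (integrableD measurableT iK (iZ _ (g ^+ 2 * 2) ie)).
pose h t := (a t - 2 * g * b t - 2 * g * c t) + (g ^+ 2 * K + g ^+ 2 * 2 * e t).
have ih : P.-integrable setT (EFin \o h).
  exact: (integrableD measurableT iabc iKe).
have a'h t : a' t <= h t by apply: le_trans (desc t) _; rewrite /h; lra.
have ia' : P.-integrable setT (EFin \o a').
  apply: le_integrable ih => //; first exact/measurable_EFinP.
  move=> t _ /=; rewrite lee_fin !ger0_norm//.
  exact: le_trans (a'0 t) (a'h t).
split => //.
have : \int[P]_t a' t <= \int[P]_t h t by apply: le_Rintegral.
have -> : \int[P]_t h t =
    \int[P]_t a t - 2 * g * \int[P]_t b t + (g ^+ 2 * K + g ^+ 2 * 2 * \int[P]_t e t).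
  rewrite RintegralD// RintegralB//; last exact: iZ.
  rewrite RintegralB//; last exact: iZ.
  rewrite RintegralD//; last exact: iZ.
  rewrite Rintegral_probability_cst.
  by rewrite !RintegralZl// c0 mulr0 subr0.
have := ler_wpM2l (sqr_ge0 g) eM; lra.
Qed.

(** * The stochastic gradient-response scheme *)

Section SchemeAnalysis.
Context {R : realType} {d : measure_display} {Omega : measurableType d}.
Variable P : probability Omega R.
Context {N m : nat} {n : 'I_N -> nat}.
Variable X : forall i : 'I_N, set 'rV[R]_(n i).
Arguments X : clear implicits.
Variable xi : Omega -> 'rV[R]_m.
Variable ft : 'I_N -> profile R n -> 'rV[R]_m -> R.
Variable gamma : nat -> R.
Variable xis : nat -> 'I_N -> Omega -> 'rV[R]_m.
Variable x : nat -> Omega -> profile R n.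
Hypothesis hA : assumptionA P X xi ft.
Hypothesis hFcont : {within joint X, continuous (pseudograd P xi ft)}.
Hypothesis hgamma0 : forall k, 0 <= gamma k.
Hypothesis hx : SSGR P X xi ft gamma xis x.
Hypothesis hB : assumptionB P X xi ft xis x.

Local Notation F := (pseudograd P xi ft).
Local Notation "'w_ k" := (noise P xi ft xis x k) (at level 8, k at level 2).

(** The generators of the history up to time [k], on their own so that
    [g_sigma_algebraType] makes the history a measurable space. *)
Definition past (k : nat) : set (set Omega) :=
  preimage_set_system setT (x 0%N) open `|`
    \bigcup_(t in [set t : nat | (t < k)%N]) \bigcup_(i in [set: 'I_N])
      preimage_set_system setT (sampled_grad ft xis x t i) open.

Local Notation adapted k f :=
  (@measurable_fun _ _ (g_sigma_algebraType (past k)) _ setT f).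

Lemma past_sub j k : (j <= k)%N -> <<s past j >> `<=` <<s past k >>.
Proof.
move=> jk; apply: (@sub_smallest2r _ _ (past j) (past k)).
  exact: smallest_sigma_algebra.
move=> A [|[t /= tj tA]].
  by left.
by right; exists t => //=; exact: leq_trans tj jk.
Qed.

Lemma adapted_le d' (T : measurableType d') (f : Omega -> T) j k :
  (j <= k)%N -> adapted j f -> adapted k f.
Proof. by move=> jk mf _ B mB; apply: (past_sub jk); exact: mf. Qed.

Lemma iterate_joint k w : joint X (x k w).
Proof.
case: k => [|k] i; first exact: (SSGR_init hx).
rewrite (SSGR_step hx).
have [xs [Xxs _]] := A3_nonempty hA.
exact: (eprojP _ (A1_closed hA (i:=i)) (ex_intro _ _ (Xxs i))).1.
Qed.

Lemma submxrow_noise k w i :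
  submxrow ('w_k w + F (x k w)) i = sampled_grad ft xis x k i w.
Proof. by rewrite submxrowD !mxrowK subrK. Qed.

(** The first iterate generates part of the history, and each later one is a
    continuous function of the previous iterate and of recorded gradients. *)
Lemma iterate_adapted k U : open U -> <<s past k >> (x k @^-1` U).
Proof.
elim: k U => [|k ih] U oU.
  by apply: sub_sigma_algebra; left; exists U => //; rewrite setTI.
pose G := g_sigma_algebraType (past k.+1).
apply: (@measurable_vector _ _ _ G (x k.+1) U) => // s.
pose i := tagnat.sig1 s.
have -> : (fun w => x k.+1 w 0 s) = (fun w =>
    eproj (X i) (submxrow (x k w) i - gamma k *: sampled_grad ft xis x k i w)
    0 (tagnat.sig2 s)).
  by apply/funext => w; rewrite -(SSGR_step hx) mxE tagnat.sig2K.
apply: (@measurable_coord _ _ _ G) => B oB.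
have cE : continuous (eproj (X i)).
  apply: eproj_continuous; [exact: (A1_closed hA (i:=i))|exact: (A1_convex hA (i:=i))|].
  by have [xs [Xxs _]] := A3_nonempty hA; exists (submxrow xs i).
have oC : open (eproj (X i) @^-1` B) by apply: open_comp => // z _; exact: cE.
apply: (@measurable_vector _ _ _ G
  (fun w => submxrow (x k w) i - gamma k *: sampled_grad ft xis x k i w) _ _ oC).
move=> j.
have -> : (fun w => (submxrow (x k w) i -
    gamma k *: sampled_grad ft xis x k i w) 0 j) =
    (fun w => x k w 0 (tagnat.Rank i j) -
      gamma k * sampled_grad ft xis x k i w 0 j).
  apply/funext => w.
  by rewrite mxE [X in X + _]mxE [X in _ + X]mxE [X in - X]mxE.
apply: (@measurable_funB _ G).
  apply: (@measurable_coord _ _ _ G) => A oA.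
  exact: past_sub (leqnSn k) _ (ih _ oA).
apply: (@measurable_funM _ G); first exact: measurable_cst.
apply: (@measurable_coord _ _ _ G) => A oA.
apply: sub_sigma_algebra; right; exists k => //=; exists i => //.
by exists A => //; rewrite setTI.
Qed.

Lemma iterate_coord_adapted k j : adapted k (fun w => x k w 0 j).
Proof.
apply: (@measurable_coord _ _ _ (g_sigma_algebraType (past k))).
exact: iterate_adapted.
Qed.

Lemma pseudograd_adapted k j : adapted k (fun w => F (x k w) 0 j).
Proof.
apply: (@measurable_coord _ _ _ (g_sigma_algebraType (past k)) (F \o x k)).
move=> U oU; have /continuousP/(_ _ oU)/open_subspaceP[V oV VU] := hFcont.
suff -> : (F \o x k) @^-1` U = x k @^-1` V by exact: iterate_adapted.
apply/seteqP; split=> w /= H; have Xw := iterate_joint k w.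
  by have [] : (V `&` joint X) (x k w) by rewrite VU; split.
by have [] : (F @^-1` U `&` joint X) (x k w) by rewrite -VU; split.
Qed.

(** The sampled gradient is the integrable, hence measurable, noise plus a
    continuous function of the current iterate; so each history only contains
    events. *)
Lemma past_measurable k : <<s past k >> `<=` @measurable _ Omega.
Proof.
elim: k => [|k ih]; apply: smallest_sub; try exact: sigma_algebra_measurable.
  move=> A [[B oB <-]|[t //]]; rewrite setTI.
  by apply: (SSGR_init_meas hx); exact: sub_sigma_algebra.
move=> A [H0|[t /= tk [i _ HA]]].
  by apply: ih; apply: sub_sigma_algebra; left.
move: tk; rewrite ltnS leq_eqVlt => /predU1P[tk|tk]; last first.
  by apply: ih; apply: sub_sigma_algebra; right; exists t => //; exists i.
move: HA => [B oB <-]; rewrite tk setTI.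
apply: measurable_vector => // j.
have -> : (fun w => sampled_grad ft xis x k i w 0 j) =
    (fun w => 'w_k w 0 (tagnat.Rank i j) + F (x k w) 0 (tagnat.Rank i j)).
  by apply/funext => w; rewrite -submxrow_noise mxE [LHS]mxE.
apply: measurable_funD.
  have [/measurable_int/measurable_EFinP //] := B1 hB k (tagnat.Rank i j).
exact: (adapted_measurable ih (@pseudograd_adapted k (tagnat.Rank i j))).
Qed.

Variable xs : profile R n.
Hypothesis xs_sol : VI_sol (joint X) F xs.
Hypothesis D_ge0 : forall y, joint X y -> 0 <= dot (y - xs) (F y).

Local Notation V k w := (dot (x k w - xs) (x k w - xs)).
Local Notation D k w := (dot (x k w - xs) (F (x k w))).
Local Notation W k w := (dot ('w_k w) ('w_k w)).

(** The update acts block by block; adding up the contraction towards each block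
    of [xs] gives the contraction of the whole profile. *)
Lemma distance_step (MF : R) k w :
  (forall y, joint X y -> enorm (F y) <= MF) ->
  V k.+1 w <= V k w - 2 * gamma k * D k w
    - 2 * gamma k * dot (x k w - xs) ('w_k w)
    + gamma k ^+ 2 * (2 * MF ^+ 2 + 2 * W k w).
Proof.
move=> FM; pose g := 'w_k w + F (x k w).
have Xw := iterate_joint k w.
have : V k.+1 w <= dot (x k w - gamma k *: g - xs) (x k w - gamma k *: g - xs).
  rewrite !dot_submxrow; apply: ler_sum => i _.
  rewrite !submxrowB (SSGR_step hx) -submxrow_noise.
  have -> : submxrow (gamma k *: g) i = gamma k *: submxrow g i.
    by apply/rowP => j; rewrite !mxE.
  apply: eproj_dist; [exact: (A1_closed hA (i:=i))|exact: (A1_convex hA (i:=i))|].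
  by case: xs_sol.
have -> : x k w - gamma k *: g - xs = (x k w - xs) - gamma k *: g.
  by rewrite addrAC.
move=> /le_trans; apply.
have gM : dot g g <= 2 * MF ^+ 2 + 2 * W k w.
  apply: le_trans (dotD_le _ _) _; rewrite addrC lerD2r ler_pM2l//.
  have := FM _ Xw; rewrite -enorm_sqr => FxM.
  by rewrite lerXn2r ?nnegrE ?sqrtr_ge0// (le_trans _ FxM) ?sqrtr_ge0.
have := ler_wpM2l (sqr_ge0 (gamma k)) gM; rewrite expr2.
move: (x k w - xs) => z.
rewrite dot_step.
have -> : dot z g = dot z ('w_k w) + dot z (F (x k w)) by rewrite dotDr.
lra.
Qed.

(** The initial distance may fail to be integrable; this positive weight,
    known from the start, makes it so without affecting almost sure bounds. *)
Definition weight w : R := expR (- V 0%N w).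

Lemma weight_gt0 w : 0 < weight w. Proof. exact: expR_gt0. Qed.

Lemma weight_le1 w : weight w <= 1.
Proof. by rewrite /weight -[leRHS]expR0 ler_expR oppr_le0 dot_ge0. Qed.

Lemma weight_distance0 w : weight w * V 0%N w <= 1.
Proof.
rewrite /weight expRN mulrC ler_pdivrMr ?expR_gt0// mul1r.
by apply: le_trans (expR_ge1Dx _); rewrite lerDr.
Qed.

Lemma distance_adapted k : adapted k (fun w => V k w).
Proof.
rewrite /dot; apply: (@measurable_sum _ (g_sigma_algebraType (past k))) => j.
apply: (@measurable_funM _ (g_sigma_algebraType (past k)));
  under eq_fun do rewrite !mxE;
  apply: (@measurable_funB _ (g_sigma_algebraType (past k)));
  by [exact: iterate_coord_adapted|exact: measurable_cst].
Qed.

Lemma weight_adapted k : adapted k weight.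
Proof.
apply: (@adapted_le _ _ _ 0%N) => //.
apply: (@measurableT_comp _ _ _ (g_sigma_algebraType (past 0))) => //.
apply: (@measurableT_comp _ _ _ (g_sigma_algebraType (past 0))) => //.
exact: distance_adapted.
Qed.

Lemma noise_integrable k j : P.-integrable setT (EFin \o (fun w => 'w_k w 0 j)).
Proof. by have [] := B1 hB k j. Qed.

Lemma noise_mean0 k j A :
  <<s past k >> A -> (\int[P]_(w in A) ('w_k w 0 j)%:E = 0)%E.
Proof.
by have [_ _ _ e] := B1 hB k j => /e ->; rewrite integral0_eq.
Qed.

(** The almost sure bound on the conditional second moment is integrated after
    truncating the conditional expectation at the bound. *)
Lemma noise_sqr_le : exists2 M : R, 0 <= M & forall k,
  P.-integrable setT (EFin \o (fun w => W k w)) /\ \int[P]_w W k w <= M.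
Proof.
have [Mw Mw0 MwP] := B2 hB; exists (Mw ^+ 2); first exact: sqr_ge0.
move=> k; have [Z [iW iZ _ WZ] Zle] := MwP k.
have WE : (fun w => W k w) = (fun w => enorm ('w_k w) ^+ 2).
  by apply/funext => w; rewrite enorm_sqr.
rewrite WE; split=> //.
rewrite /Rintegral WZ; last exact: (@measurableT _ (g_sigma_algebraType (past k))).
have iZ' : P.-integrable setT (EFin \o (fun w => Num.min (Z w) (Mw ^+ 2))).
  apply: (@le_integrable _ _ _ _ _ measurableT _
    (fun w => (`|Z w| + Mw ^+ 2)%:E)).
  - apply/measurable_EFinP; apply: measurable_minr => //.
    exact/measurable_EFinP/(measurable_int P).
  - move=> w _ /=; rewrite lee_fin.
    have M0 : 0 <= Mw ^+ 2 by exact: sqr_ge0.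
    rewrite [leRHS]ger0_norm ?addr_ge0//.
    by case: (leP (Z w) (Mw ^+ 2)) => _; rewrite ?lerDl// ger0_norm ?lerDr.
  - exact: (integrableD measurableT (integrable_norm iZ)
      (finite_measure_integrable_cst P (Mw ^+ 2) measurableT)).
have -> : (\int[P]_w (Z w)%:E = \int[P]_w (Num.min (Z w) (Mw ^+ 2))%:E)%E.
  apply: ae_eq_integral => //; [exact: measurable_int iZ|exact: measurable_int iZ'|].
  by apply: filterS Zle => w Zw _; rewrite min_l.
have iM : P.-integrable setT (EFin \o (fun=> Mw ^+ 2)).
  exact: (finite_measure_integrable_cst P (Mw ^+ 2) measurableT).
have minM w : setT w -> Num.min (Z w) (Mw ^+ 2) <= Mw ^+ 2.
  by rewrite ge_min lexx orbT.
have := le_Rintegral measurableT iZ' iM minM.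
by move=> /le_trans; apply; rewrite Rintegral_probability_cst.
Qed.

(** The noise has zero mean given the past, on which both the iterate and the
    weight depend. *)
Lemma weighted_noise k :
  P.-integrable setT (EFin \o (fun w => weight w * V k w)) ->
  P.-integrable setT
    (EFin \o (fun w => weight w * dot (x k w - xs) ('w_k w))) /\
  \int[P]_w (weight w * dot (x k w - xs) ('w_k w)) = 0.
Proof.
move=> iV; have [M _ MP] := noise_sqr_le; have [iW _] := MP k.
pose Y j w := weight w * (x k w 0 j - xs 0 j).
have mY j : adapted k (Y j).
  apply: (@measurable_funM _ (g_sigma_algebraType (past k))).
    exact: weight_adapted.
  apply: (@measurable_funB _ (g_sigma_algebraType (past k))).
    exact: iterate_coord_adapted.
  exact: measurable_cst.
have iY j : P.-integrable setT (fun w => (Y j w * 'w_k w 0 j)%:E).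
  apply: (le_integrable measurableT _ _ (integrableD measurableT iV iW)).
    apply/measurable_EFinP; apply: measurable_funM.
      exact: (adapted_measurable (@past_measurable k) (mY j)).
    exact/measurable_EFinP/(measurable_int P)/(noise_integrable k j).
  move=> w _ /=; rewrite lee_fin.
  have rho0 := weight_gt0 w; have rho1 := weight_le1 w.
  have V0 := dot_ge0 (x k w - xs); have W0 := dot_ge0 ('w_k w).
  rewrite [leRHS]ger0_norm; last first.
    by rewrite addr_ge0// mulr_ge0// ltW.
  have zV : (x k w 0 j - xs 0 j) ^+ 2 <= V k w.
    by have := ler_coord_dot (x k w - xs) j; rewrite mxE [X in _ + X]mxE.
  have wW := ler_coord_dot ('w_k w) j.
  rewrite /Y -mulrA normrM gtr0_norm//.
  apply: (@le_trans _ _ (weight w * (V k w + W k w))).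
    rewrite ler_pM2l// normrM.
    set s := x k w 0 j - xs 0 j in zV *; set t := 'w_k w 0 j in wW *.
    have := sqr_ge0 (`|s| - `|t|); rewrite sqrrB !real_normK ?num_real//.
    have := sqr_ge0 s; have := sqr_ge0 t; lra.
  by rewrite mulrDr lerD2l ler_piMl.
have -> : (fun w => weight w * dot (x k w - xs) ('w_k w)) =
    (fun w => \sum_j Y j w * 'w_k w 0 j).
  apply/funext => w; rewrite /dot mulr_sumr; apply: eq_bigr => j _.
  by rewrite /Y mulrA mxE [X in _ + X]mxE.
have sE : EFin \o (fun w => \sum_j Y j w * 'w_k w 0 j) =
    (fun w => \sum_j (Y j w * 'w_k w 0 j)%:E)%E.
  by apply/funext => w /=; rewrite sumEFin.
split; first by rewrite sE; apply: integrable_sum.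
rewrite /Rintegral.
under eq_integral do rewrite -sumEFin.
rewrite integral_sum// big1// => j _.
apply: (orthogonal_adapted (@past_measurable k)) => //.
  exact: noise_integrable.
by move=> A; exact: noise_mean0.
Qed.

(** The expected form of [distance_step]; the error term is not weighted because
    the weight is at most 1. *)
Lemma weighted_step (MF M : R) k :
  (forall y, joint X y -> enorm (F y) <= MF) ->
  P.-integrable setT (EFin \o (fun w => W k w)) -> \int[P]_w W k w <= M ->
  P.-integrable setT (EFin \o (fun w => weight w * V k w)) ->
  [/\ P.-integrable setT (EFin \o (fun w => weight w * D k w)),
      P.-integrable setT (EFin \o (fun w => weight w * V k.+1 w)) &
      \int[P]_w (weight w * V k.+1 w) +
        2 * gamma k * \int[P]_w (weight w * D k w) <=
      \int[P]_w (weight w * V k w) + gamma k ^+ 2 * (2 * MF ^+ 2 + 2 * M)].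
Proof.
move=> FM iW WM iV; have [ic c0] := weighted_noise iV.
have mrho : measurable_fun setT weight.
  exact: (adapted_measurable (@past_measurable 0%N) (@weight_adapted 0%N)).
have mV j : measurable_fun setT (fun w => V j w).
  exact: (adapted_measurable (@past_measurable j) (@distance_adapted j)).
have mD : measurable_fun setT (fun w => D k w).
  apply: (adapted_measurable (@past_measurable k)).
  rewrite /dot; apply: (@measurable_sum _ (g_sigma_algebraType (past k))) => j.
  apply: (@measurable_funM _ (g_sigma_algebraType (past k))).
    have -> : (fun w => (x k w - xs) 0 j) = (fun w => x k w 0 j - xs 0 j).
      by apply/funext => w; rewrite mxE [X in _ + X]mxE.
    apply: (@measurable_funB _ (g_sigma_algebraType (past k))).
      exact: iterate_coord_adapted.
    exact: measurable_cst.
  exact: pseudograd_adapted.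
have iD : P.-integrable setT (EFin \o (fun w => weight w * D k w)).
  have iC := finite_measure_integrable_cst P (MF ^+ 2) measurableT.
  apply: (le_integrable measurableT _ _ (integrableD measurableT iV iC)).
    by apply/measurable_EFinP; exact: measurable_funM.
  move=> w _ /=; rewrite lee_fin.
  have Xw := iterate_joint k w.
  have rho0 := weight_gt0 w; have rho1 := weight_le1 w.
  have V0 := dot_ge0 (x k w - xs); have D0 := D_ge0 Xw.
  have F2 : dot (F (x k w)) (F (x k w)) <= MF ^+ 2.
    rewrite -enorm_sqr; have FxM := FM _ Xw.
    have MF0 : 0 <= MF := le_trans (sqrtr_ge0 _) FxM.
    by rewrite lerXn2r ?nnegrE ?sqrtr_ge0.
  have DV := dot_le_sqr (x k w - xs) (F (x k w)).
  have MF0 := sqr_ge0 MF; rewrite (ger0_norm D0) in DV.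
  rewrite [leLHS]ger0_norm; last by rewrite mulr_ge0// ltW.
  rewrite [leRHS]ger0_norm; last by rewrite addr_ge0// mulr_ge0// ltW.
  apply: (@le_trans _ _ (weight w * (V k w + MF ^+ 2))).
    by rewrite ler_pM2l//; have := dot_ge0 (F (x k w)); lra.
  by rewrite mulrDr lerD2l ler_piMl.
have [|||iV' step] := @Rintegral_descent R _ _ P (fun w => weight w * V k w)
  (fun w => weight w * V k.+1 w) _ _ _ (gamma k) (2 * MF ^+ 2) M iV iD ic iW _ _ c0 WM.
- exact: measurable_funM.
- by move=> w; rewrite mulr_ge0 ?dot_ge0// ltW// weight_gt0.
- move=> w; have rho0 := weight_gt0 w; have rho1 := weight_le1 w.
  have := ler_wpM2l (ltW rho0) (distance_step k w FM).
  set E := gamma k ^+ 2 * _.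
  have E0 : 0 <= E.
    rewrite mulr_ge0 ?sqr_ge0// addr_ge0// mulr_ge0// ?sqr_ge0//.
    exact: dot_ge0.
  have : weight w * E <= E by rewrite ler_piMl.
  lra.
- by split.
Qed.

(** The expected one-step inequalities telescope, and the squared stepsizes are
    summable. *)
Lemma weighted_bounds (G2 : R) :
  (forall k, \sum_(0 <= j < k) gamma j ^+ 2 <= G2) ->
  exists2 B, 0 <= B & forall k,
    [/\ P.-integrable setT (EFin \o (fun w => weight w * V k w)),
        P.-integrable setT (EFin \o (fun w => weight w * D k w)),
        \int[P]_w (weight w * V k w) <= B &
        \sum_(0 <= j < k) gamma j * \int[P]_w (weight w * D j w) <= B].
Proof.
move=> G2P; have [M M0 MP] := noise_sqr_le; have [MF _ FM] := B3 hB.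
set C := 2 * MF ^+ 2 + 2 * M.
have C0 : 0 <= C by rewrite addr_ge0// mulr_ge0// sqr_ge0.
have iV0 : P.-integrable setT (EFin \o (fun w => weight w * V 0%N w)).
  have i1 := finite_measure_integrable_cst P (1 : R) measurableT.
  apply: (le_integrable measurableT _ _ i1).
    apply/measurable_EFinP; apply: measurable_funM.
      exact: (adapted_measurable (@past_measurable 0%N) (@weight_adapted 0%N)).
    exact: (adapted_measurable (@past_measurable 0%N) (@distance_adapted 0%N)).
  move=> w _ /=; rewrite lee_fin normr1 ger0_norm ?weight_distance0//.
  by rewrite mulr_ge0 ?dot_ge0// ltW// weight_gt0.
have D0 j : 0 <= \int[P]_w (weight w * D j w).
  apply: Rintegral_ge0 => w _; rewrite mulr_ge0 ?(ltW (weight_gt0 w))//.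
  exact/D_ge0/iterate_joint.
have V0 j : 0 <= \int[P]_w (weight w * V j w).
  by apply: Rintegral_ge0 => w _; rewrite mulr_ge0 ?dot_ge0 ?(ltW (weight_gt0 w)).
have main k : P.-integrable setT (EFin \o (fun w => weight w * V k w)) /\
    \int[P]_w (weight w * V k w) +
      2 * (\sum_(0 <= j < k) gamma j * \int[P]_w (weight w * D j w)) <=
    1 + (\sum_(0 <= j < k) gamma j ^+ 2) * C.
  elim: k => [|k [iV ih]].
    split=> //; rewrite !big_nil mulr0 mul0r !addr0.
    have i1 := finite_measure_integrable_cst P (1 : R) measurableT.
    have := le_Rintegral measurableT iV0 i1 (fun w _ => weight_distance0 w).
    by rewrite Rintegral_probability_cst.
  have [iW WM] := MP k.
  have [_ iV' step] := weighted_step FM iW WM iV; split=> //.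
  rewrite !big_nat_recr//= mulrDl mulrDr; move: step; rewrite -/C; lra.
have G20 : 0 <= G2 by apply: le_trans (G2P 0%N); rewrite big_nil.
have B0 : 0 <= 1 + G2 * C by rewrite addr_ge0// mulr_ge0.
exists (1 + G2 * C) => // k; have [iV le] := main k.
have [iW WM] := MP k; have [iD _ _] := weighted_step FM iW WM iV.
have := ler_wpM2r C0 (G2P k).
have S0 : 0 <= \sum_(0 <= j < k) gamma j * \int[P]_w (weight w * D j w).
  by apply: sumr_ge0 => j _; rewrite mulr_ge0.
have V0k := V0 k; split => //; lra.
Qed.

(** Both bounds come from one nonnegative variable with bounded expectation, so
    that they hold at the same times and Fatou's lemma applies once. *)
Lemma often_bounded_ae (G2 : R) :
  (forall k, \sum_(0 <= j < k) gamma j ^+ 2 <= G2) ->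
  {ae P, forall w, exists2 L, 0 < L & forall n0, exists k, [/\ (n0 <= k)%N,
     \sum_(0 <= j < k) gamma j * D j w <= L &
     \sum_(0 <= j < k) gamma j * V j w <= L * \sum_(0 <= j < k) gamma j]}.
Proof.
move=> /weighted_bounds[B B0 BP].
pose S k := \sum_(0 <= j < k) gamma j.
have S0 k : 0 <= S k by exact: sumr_ge0.
(* While all steps vanish, S k = 0 and its inverse is 0, so T k = 0. *)
pose T k w := \sum_(0 <= j < k) (gamma j * (weight w * D j w) +
  (S k)^-1 * gamma j * (weight w * V j w)).
have iT k j : P.-integrable setT (EFin \o (fun w =>
    gamma j * (weight w * D j w) + (S k)^-1 * gamma j * (weight w * V j w))).
  have [iV iD _ _] := BP j.
  exact: (integrableD measurableT (integrableZl measurableT (gamma j) iD)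
    (integrableZl measurableT ((S k)^-1 * gamma j) iV)).
have TE k : (fun w => (T k w)%:E) = (fun w => \sum_(0 <= j < k)
    (gamma j * (weight w * D j w) +
      (S k)^-1 * gamma j * (weight w * V j w))%:E)%E.
  by apply/funext => w; rewrite sumEFin.
have T0 k w : 0 <= T k w.
  have rho0 := ltW (weight_gt0 w).
  apply: sumr_ge0 => j _; rewrite addr_ge0// !mulr_ge0 ?invr_ge0 ?dot_ge0//.
  exact/D_ge0/iterate_joint.
have mT k : measurable_fun setT (T k).
  apply/measurable_EFinP; rewrite /comp TE.
  apply: emeasurable_sum => j; exact: (measurable_int P (iT k j)).
have TB k : (\int[P]_w (T k w)%:E <= (2 * B)%:E)%E.
  rewrite TE (integral_sum measurableT (iT k)).
  have E j : (\int[P]_w (gamma j * (weight w * D j w) +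
      (S k)^-1 * gamma j * (weight w * V j w))%:E =
      (gamma j * \int[P]_w (weight w * D j w) +
      (S k)^-1 * gamma j * \int[P]_w (weight w * V j w))%:E)%E.
    have [iV iD _ _] := BP j.
    rewrite -RintegralZl// -RintegralZl// -RintegralD//.
    - by rewrite /Rintegral fineK//; apply: integrable_fin_num (iT k j).
    - exact: (integrableZl measurableT (gamma j) iD).
    - exact: (integrableZl measurableT ((S k)^-1 * gamma j) iV).
  rewrite (eq_bigr _ (fun j _ => E j)) sumEFin lee_fin [leLHS]big_split/=.
  have [_ _ _ DB] := BP k.
  suff : \sum_(0 <= j < k) (S k)^-1 * gamma j * \int[P]_w (weight w * V j w) <= B.
    lra.
  apply: (@le_trans _ _ (\sum_(0 <= j < k) (S k)^-1 * gamma j * B)).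
    apply: ler_sum => j _; have [_ _ VB _] := BP j.
    by rewrite ler_wpM2l// mulr_ge0 ?invr_ge0.
  rewrite -mulr_suml -mulr_sumr -/(S k) ler_piMl//.
  have [->|Sk] := eqVneq (S k) 0; first by rewrite mulr0.
  by rewrite mulVf.
have := ae_often_bounded mT T0 TB; apply: filterS => w [L LP].
have rho0 := weight_gt0 w.
have L0 : 0 < `|L| / weight w + 1 by rewrite ltr_wpDl// divr_ge0// ltW.
exists (`|L| / weight w + 1) => // n0.
have [k nk TL] := LP n0; exists k; split=> //.
  apply: (@le_trans _ _ (`|L| / weight w)); last by rewrite lerDl.
  rewrite ler_pdivlMr// mulr_suml; apply: le_trans (ler_norm L).
  apply: le_trans TL; apply: ler_sum => j _.
  rewrite (_ : gamma j * D j w * weight w = gamma j * (weight w * D j w));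
    last by ring.
  rewrite lerDl.
  by rewrite !mulr_ge0 ?invr_ge0 ?dot_ge0// ltW.
have [Sk|Sk] := eqVneq (S k) 0.
  rewrite -/(S k) Sk mulr0; have g0 j : (0 <= j < k)%N -> gamma j = 0.
    move=> jk; have /eqP := Sk; rewrite /S psumr_eq0// => /allP/(_ j).
    by rewrite mem_index_iota => /(_ jk)/eqP.
  by rewrite big_nat big1// => j /g0 ->; rewrite mul0r.
have Sk0 : 0 < S k by rewrite lt_neqAle eq_sym Sk S0.
apply: (@le_trans _ _ (`|L| / weight w * S k)); last first.
  by rewrite -/(S k) ler_pM2r// lerDl.
rewrite mulrAC ler_pdivlMr// -ler_pdivrMr// !mulr_suml.
apply: le_trans (ler_norm L); apply: le_trans TL; apply: ler_sum => j _.
rewrite (_ : gamma j * V j w * weight w / S k =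
  (S k)^-1 * gamma j * (weight w * V j w)); last by ring.
rewrite lerDr !mulr_ge0//; first exact: ltW.
exact/D_ge0/iterate_joint.
Qed.

End SchemeAnalysis.

(** * Quasi-Nash equilibria *)

Lemma VI_sol_QNE {R : realType} {d : measure_display} {Omega : measurableType d}
    (P : probability Omega R) {N m : nat} {n : 'I_N -> nat}
    (X : forall i : 'I_N, set 'rV[R]_(n i)) (xi : Omega -> 'rV[R]_m)
    (ft : 'I_N -> profile R n -> 'rV[R]_m -> R) :
  VI_sol (joint X) (pseudograd P xi ft) `<=` QNE P X xi ft.
Proof.
move=> l [Xl lP]; split=> // i y Xy.
have Xd : joint X (deviate l y).
  move=> j; rewrite submxrow_deviate.
  by case: dfwithP => // k ik; exact: Xl.
by have := lP _ Xd; rewrite dot_deviate mxrowK.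
Qed.

Theorem theorem3p3 (R : realType) (d : measure_display)
    (Omega : measurableType d) (P : probability Omega R)
    (N m : nat) (n : 'I_N -> nat)
    (X : forall i : 'I_N, set 'rV[R]_(n i))
    (xi : Omega -> 'rV[R]_m)
    (ft : 'I_N -> profile R n -> 'rV[R]_m -> R)
    (gamma : nat -> R)
    (xis : nat -> 'I_N -> Omega -> 'rV[R]_m)
    (x : nat -> Omega -> profile R n)
    (hN : (0 < N)%N)
    (hxi : random_vector xi)
    (hA : assumptionA P X xi ft)
    (hFcont : {within joint X, continuous (pseudograd P xi ft)})
    (hacute : acute_angle (joint X) (pseudograd P xi ft))
    (hgamma0 : forall k, 0 <= gamma k)
    (hgamma1 : (\sum_(0 <= k <oo) (gamma k)%:E = +oo)%E)
    (hgamma2 : (\sum_(0 <= k <oo) (gamma k ^+ 2)%:E < +oo)%E)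
    (hx : SSGR P X xi ft gamma xis x)
    (hB : assumptionB P X xi ft xis x)
    (hcompact : compact (VI_sol (joint X) (pseudograd P xi ft))) :
  {ae P, forall w, exists (s : nat -> nat) (xs : profile R n),
     [/\ {homo s : a b / (a < b)%N},
         QNE P X xi ft xs
       & x (s k) w @[k --> \oo] --> xs]}.
Proof.
have [xs xs_sol] := A3_nonempty hA.
have clX : closed (joint X).
  by apply: joint_closed => i; exact: (A1_closed hA (i:=i)).
have cvX : forall y z (t : R), joint X y -> joint X z -> 0 <= t -> t <= 1 ->
    joint X (t *: y + (1 - t) *: z).
  move=> y z t; apply: joint_convex => i; exact: (A1_convex hA (i:=i)).
have D0 y : joint X y -> 0 <= dot (y - xs) (pseudograd P xi ft y).
  by move=> Xy; exact: (acute_ge0 cvX hFcont hacute Xy xs_sol).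
have [G2 G2P] := partial_sums_le (fun k => sqr_ge0 (gamma k)) hgamma2.
have := often_bounded_ae hA hFcont hgamma0 hx hB xs_sol D0 G2P.
apply: filterS => w [L L0 often].
have Xw k : joint X (x k w) := iterate_joint hA hx k w.
have visits := weighted_visits hgamma0 (fun k => D0 _ (Xw k))
  (fun k => dot_ge0 (x k w - xs)) (partial_sums_unbounded hgamma0 hgamma1)
  L0 often.
have [s [l [s_incr l_sol sl]]] :=
  acute_cluster hFcont hacute clX xs_sol Xw visits.
by exists s, l; split=> //; exact: VI_sol_QNE.
Qed.
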